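(* Let $G$ be a finite triangle-free simple graph. Then $\bar{\tau}(G)\neq 0$ if and only if $G$ is bipartite. Moreover, if $G$ is a connected bipartite graph with at least two vertices, then $$\bar{\tau}(G)=\begin{cases}3 & \text{if } G=K_2,\\ 2 & \text{if } G\neq K_2,\end{cases}\qquad \hbar(G)=\begin{cases}1 & \text{if } G\neq K_2 \text{ and } G \text{ is reflexible},\\ 2 & \text{otherwise}.\end{cases}$$
   Context: For a topology $\mathcal{T}$ on a finite set $X$, its underlying graph is the simple graph on $X$ in which distinct $x,y$ are adjacent iff $x\in\overline{\{y\}}$ or $y\in\overline{\{x\}}$ (closures in $\mathcal{T}$). For a finite simple graph $G$, $\bar{\tau}(G)$ is the number of topologies on $V(G)$ whose underlying graph is exactly $G$, and $\hbar(G)$ is the number of pairwise non-homeomorphic such topologies. $K_2$ is the complete graph on two vertices. A connected bipartite graph with bipartition $\{X_1,X_2\}$ is called reflexible if it has a graph automorphism mapping $X_1$ onto $X_2$. *)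

(* Defs.v *)
From mathcomp Require Import all_boot all_fingroup.

Set Implicit Arguments.
Unset Strict Implicit.
Unset Printing Implicit Defensive.

(* A finite simple graph on T is a symmetric irreflexive e : rel T; a topology
   on T is represented by its set of open sets, O : {set {set T}}. *)

Section Topology.
Variable T : finType.
Implicit Types (O : {set {set T}}) (A U V : {set T}).

Definition topology O : bool :=
  [&& set0 \in O, [set: T] \in O,
      [forall U in O, forall V in O, U :&: V \in O] &
      [forall S : {set {set T}}, (S \subset O) ==> (cover S \in O)]].

Definition closure O A : {set T} :=
  \bigcap_(C : {set T} | (~: C \in O) && (A \subset C)) C.

Definition continuous O1 O2 (f : T -> T) : bool :=
  [forall V in O2, f @^-1: V \in O1].

Definition homeomorphic O1 O2 : bool :=
  [exists s : {perm T}, continuous O1 O2 s && continuous O2 O1 (s^-1)%g].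

Lemma homeomorphic_refl O : homeomorphic O O.
Proof.
apply/existsP; exists 1%g; rewrite invg1 andbb.
apply/forall_inP => V VO; suff -> : (1%g : {perm T}) @^-1: V = V by [].
by apply/setP=> x; rewrite inE perm1.
Qed.

Lemma homeomorphic_sym : symmetric homeomorphic.
Proof.
have imp O1 O2 : homeomorphic O1 O2 -> homeomorphic O2 O1.
  case/existsP=> s /andP[c12 c21]; apply/existsP.
  by exists (s^-1)%g; rewrite invgK c21 c12.
by move=> O1 O2; apply/idP/idP; apply: imp.
Qed.

Lemma homeomorphic_trans : transitive homeomorphic.
Proof.
have comp O1 O2 O3 (s t : {perm T}) :
  continuous O1 O2 s -> continuous O2 O3 t -> continuous O1 O3 (s * t)%g.
  move=> /forall_inP c12 /forall_inP c23; apply/forall_inP => V /c23/c12.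
  suff -> : (s * t)%g @^-1: V = s @^-1: (t @^-1: V) by [].
  by apply/setP=> x; rewrite !inE permM.
move=> O2 O1 O3 /existsP[s /andP[s12 s21]] /existsP[t /andP[t23 t32]].
apply/existsP; exists (s * t)%g; rewrite invMg (comp _ O2) //=.
exact: comp t32 s21.
Qed.

End Topology.

Section Graph.
Variable T : finType.
Implicit Types (e : rel T) (O : {set {set T}}) (X : {set T}).

Definition underlying_graph O : rel T := fun x y =>
  (x != y) && ((x \in closure O [set y]) || (y \in closure O [set x])).

Definition topologies_of e : {set {set {set T}}} :=
  [set O | topology O & [forall x, forall y, underlying_graph O x y == e x y]].

Definition tau_bar e : nat := #|topologies_of e|.

(* The number of homeomorphism classes of topologies with underlying graph e. *)
Definition hbar e : nat :=
  #|equivalence_partition (@homeomorphic T) (topologies_of e)|.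

Definition triangle_free e : Prop :=
  forall x y z, ~~ [&& e x y, e y z & e z x].

Definition connected e : Prop := forall x y, connect e x y.

(* Parts may be empty: an edgeless graph is bipartite. *)
Definition bipartition e X1 X2 : bool :=
  [&& X1 :|: X2 == [set: T], [disjoint X1 & X2] &
      [forall x, forall y, e x y ==>
        ((x \in X1) && (y \in X2)) || ((x \in X2) && (y \in X1))]].

Definition bipartite e : bool :=
  [exists X1, exists X2, bipartition e X1 X2].

Definition is_K2 e : bool :=
  (#|T| == 2) && [forall x, forall y, e x y == (x != y)].

Definition automorphism e (s : {perm T}) : bool :=
  [forall x, forall y, e (s x) (s y) == e x y].

(* Only used for connected e, whose bipartition {X1, X2} is unique. *)
Definition reflexible e : bool :=
  [exists X1, exists X2, bipartition e X1 X2 &&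
    [exists s : {perm T}, automorphism e s && (s @: X1 == X2)]].

End Graph.

(* Main.v *)
Require Import Defs.
From mathcomp Require Import all_boot all_fingroup.

Set Implicit Arguments.
Unset Strict Implicit.
Unset Printing Implicit Defensive.

(* A topology on a finite set is the family of up-sets of its specialization
   preorder [x <= y] iff [x] lies in the closure of [y], and its underlying
   graph is the comparability graph of that preorder. In a triangle-free graph,
   [z <= x <= y] with [z, y != x] forces [z = y]; hence, once every two-point
   indiscrete component has been ordered arbitrarily, each vertex is either
   minimal or maximal, and the maximal vertices are one side of a bipartition.
   If the graph is connected and not K2, there is no indiscrete component, so
   the preorder consists of all edges oriented from one side of the unique
   bipartition to the other; the two orientations are homeomorphic iff some
   automorphism exchanges the sides. K2 has the indiscrete topology besides. *)

(** * Finite topologies as up-set families of preorders *)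

Section Specialization.
Variable T : finType.
Implicit Types (O : {set {set T}}) (U V : {set T}) (r : rel T).

Definition specialization O : rel T := fun x y => x \in Defs.closure O [set y].

Definition upsets r : {set {set T}} :=
  [set U : {set T} | [forall x, forall y, (x \in U) && r x y ==> (y \in U)]].

Lemma upsetsP r U :
  reflect (forall x y, x \in U -> r x y -> y \in U) (U \in upsets r).
Proof.
rewrite inE; apply: (iffP forallP) => [H x y xU rxy | H x].
  by have /forallP/(_ y) := H x; rewrite xU rxy.
by apply/forallP=> y; apply/implyP=> /andP[xU rxy]; apply: H rxy.
Qed.

Lemma eq_upsets r1 r2 : r1 =2 r2 -> upsets r1 = upsets r2.
Proof.
move=> r12; apply/setP=> U; apply/upsetsP/upsetsP => H x y xU rxy;
  by apply: (H x) => //; rewrite ?r12 // -r12.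
Qed.

(** Complementation turns the closed sets containing [y] into the open sets missing [y], which
    replaces closures by open neighbourhoods. *)
Lemma specializationP O x y :
  reflect (forall U, U \in O -> x \in U -> y \in U) (specialization O x y).
Proof.
apply: (iffP bigcapP) => [H U UO xU | H C /andP[CO]].
  apply: contraLR xU => yU; rewrite -in_setC; apply: H.
  by rewrite setCK UO sub1set inE.
by rewrite sub1set; apply: contraLR; rewrite -!in_setC; apply: H.
Qed.

Lemma specialization_refl O : reflexive (specialization O).
Proof. by move=> x; apply/specializationP. Qed.

Lemma specialization_trans O : transitive (specialization O).
Proof.
move=> y x z /specializationP xy /specializationP yz; apply/specializationP.
by move=> U UO /(xy _ UO)/(yz _ UO).
Qed.

(** In a finite space every point has a smallest open neighbourhood, namely the set of points above
    it. An up-set therefore contains such a neighbourhood around each of its points and is the union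
    of its open subsets. *)
Lemma upsets_specialization O : topology O -> upsets (specialization O) = O.
Proof.
case/and4P=> _ OT /forall_inP OI /forallP OU; apply/setP=> U.
apply/upsetsP/idP => [upU | UO x y xU /specializationP]; last exact.
suff -> : U = cover [set V in O | V \subset U].
  by have /implyP := OU [set V in O | V \subset U]; apply;
     apply/subsetP=> V; rewrite inE => /andP[].
apply/setP=> x; apply/idP/bigcupP => [xU | [V]]; last first.
  by rewrite inE => /andP[_ /subsetP]; apply.
(* The smallest open neighbourhood of [x]; it is open because the intersection is finite. *)
exists (\bigcap_(V in O | x \in V) V); last first.
  by apply/bigcapP=> V /andP[].
rewrite inE; apply/andP; split.
  elim/big_ind: _ => [||V /andP[]] // V W VO WO.
  by have /forall_inP := OI V VO; apply.
apply/subsetP=> y /bigcapP xy; apply: (upU x) => //.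
by apply/specializationP=> V VO xV; apply: xy; rewrite VO.
Qed.

Lemma topology_upsets r : topology (upsets r).
Proof.
apply/and4P; split.
- by apply/upsetsP=> x y; rewrite inE.
- by apply/upsetsP=> x y; rewrite !inE.
- apply/forall_inP=> U /upsetsP UP; apply/forall_inP=> V /upsetsP VP.
  apply/upsetsP=> x y; rewrite !inE => /andP[xU xV] rxy.
  by rewrite (UP x y) // (VP x y).
apply/forallP=> S; apply/implyP=> /subsetP SO; apply/upsetsP=> x y.
case/bigcupP=> U US xU rxy; apply/bigcupP; exists U => //.
by have /upsetsP/(_ x) := SO U US; apply.
Qed.

Lemma specialization_upsets r :
  reflexive r -> transitive r -> specialization (upsets r) =2 r.
Proof.
move=> rxx rtr x y; apply/specializationP/idP => [H | rxy U /upsetsP UP xU].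
  (* The principal up-set of [x] is open, by transitivity, and contains [x], by reflexivity. *)
  suff: y \in [set z | r x z] by rewrite inE.
  apply: H; last by rewrite inE.
  by apply/upsetsP=> a b; rewrite !inE; apply: rtr.
exact: UP rxy.
Qed.

(** Continuity amounts to monotonicity for the specialization preorders, so homeomorphisms are
    exactly the order isomorphisms. *)
Lemma homeomorphicP O1 O2 : topology O1 -> topology O2 ->
  reflect (exists s : {perm T},
             forall x y, specialization O1 x y = specialization O2 (s x) (s y))
          (homeomorphic O1 O2).
Proof.
move=> top1 top2.
have mono (O O' : {set {set T}}) (s : {perm T}) x y :
    continuous O O' s -> specialization O x y ->
    specialization O' (s x) (s y).
  move=> /forall_inP cs /specializationP xy; apply/specializationP=> U UO'.
  by have := xy _ (cs U UO'); rewrite !inE.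
have cont (O O' : {set {set T}}) (s : {perm T}) :
    topology O -> topology O' ->
    (forall x y, specialization O x y -> specialization O' (s x) (s y)) ->
    continuous O O' s.
  move=> tO tO' H; apply/forall_inP=> V.
  rewrite -(upsets_specialization tO) -{1}(upsets_specialization tO').
  move=> /upsetsP VP; apply/upsetsP=> x y; rewrite !inE => xV /H.
  exact: VP.
apply: (iffP existsP) => [[s /andP[c12 c21]] | [s Hs]]; exists s.
  move=> x y; apply/idP/idP; first exact: mono.
  by move=> /(mono _ _ _ _ _ c21); rewrite !permK.
rewrite !cont // => x y; first by rewrite Hs !permKV.
by rewrite Hs.
Qed.

End Specialization.

(** * Bipartitions and the topologies that orient a graph along them *)

Section TriangleFree.
Variables (T : finType) (e : rel T).
Hypotheses (e_sym : symmetric e) (e_irr : irreflexive e).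
Implicit Types (O : {set {set T}}) (X Y : {set T}).

Definition orientation X Y : rel T :=
  fun x y => (x == y) || [&& x \in X, y \in Y & e x y].

Definition orientation_topology X Y := upsets (orientation X Y).

(** Written as an up-set family so that its specialization preorder comes from the general lemma. *)
Definition indiscrete : {set {set T}} := upsets (fun _ _ : T => true).

Lemma topologies_ofP O :
  reflect (topology O /\ forall x y, e x y =
    (x != y) && (specialization O x y || specialization O y x))
  (O \in topologies_of e).
Proof.
rewrite inE; apply: (iffP andP) => -[tO H]; split=> //.
  by move=> x y; have /forallP/(_ y)/eqP := forallP H x.
by apply/forallP=> x; apply/forallP=> y; rewrite H.
Qed.

Lemma bipartitionP X1 X2 :
  reflect (X2 = ~: X1 /\ forall x y, e x y -> (y \in X1) = (x \notin X1))
          (bipartition e X1 X2).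
Proof.
apply: (iffP and3P) => [[/eqP U D /forallP E] | [-> E]].
  have defX2 : X2 = ~: X1.
    apply/setP=> x; have /setP/(_ x) := U; rewrite !inE.
    by case: (boolP (x \in X1)) => //= /(disjointFr D).
  split=> // x y exy; have /forallP/(_ y) := E x.
  by rewrite exy defX2 !inE; case: (x \in X1); case: (y \in X1).
split; first by rewrite setUCr.
  by rewrite -setI_eq0 setICr.
apply/forallP=> x; apply/forallP=> y; apply/implyP=> /E.
by rewrite !inE => ->; case: (x \in X1).
Qed.

Lemma bipartition_sym X1 X2 : bipartition e X1 X2 -> bipartition e X2 X1.
Proof.
case/bipartitionP=> -> E; apply/bipartitionP; rewrite setCK; split=> // x y.
by rewrite !inE => /E ->.
Qed.

(** Membership in [X1] and in [Y1] both flip along every edge, so their exclusive or is constant on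
    a connected graph: the sides agree everywhere or are swapped everywhere. *)
Lemma bipartition_unique X1 X2 Y1 Y2 : connected e ->
  bipartition e X1 X2 -> bipartition e Y1 Y2 ->
  (Y1 = X1 /\ Y2 = X2) \/ (Y1 = X2 /\ Y2 = X1).
Proof.
move=> conn /bipartitionP[-> EX] /bipartitionP[-> EY].
have inv : closed e [pred x | (x \in X1) (+) (x \in Y1)].
  move=> x y exy; rewrite !inE (EX _ _ exy) (EY _ _ exy).
  by case: (x \in X1); case: (x \in Y1).
have same x y : (x \in X1) (+) (x \in Y1) = (y \in X1) (+) (y \in Y1).
  by have := closed_connect inv (conn x y); rewrite !inE.
have [/existsP[x0 Hx0] | /existsPn none] :=
  boolP [exists x, (x \in X1) (+) (x \in Y1)].
  right; suff -> : Y1 = ~: X1 by rewrite setCK.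
  apply/setP=> x; move: Hx0; rewrite (same _ x) inE.
  by case: (x \in X1); case: (x \in Y1).
left; suff -> : Y1 = X1 by [].
apply/setP=> x; move: (none x).
by case: (x \in X1); case: (x \in Y1).
Qed.

Lemma orientation_refl X Y : reflexive (orientation X Y).
Proof. by move=> x; rewrite /orientation eqxx. Qed.

(** Two proper relations never compose, since the middle point would lie in both parts. *)
Lemma orientation_trans X1 X2 :
  bipartition e X1 X2 -> transitive (orientation X1 X2).
Proof.
move=> /bipartitionP[-> _] y x z /orP[/eqP-> // | /and3P[xX yX exy]].
case/orP=> [/eqP <- | /and3P[yX1 _ _]].
  by rewrite /orientation xX yX exy orbT.
by rewrite inE yX1 in yX.
Qed.

Lemma specialization_orientation X1 X2 : bipartition e X1 X2 ->
  specialization (orientation_topology X1 X2) =2 orientation X1 X2.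
Proof.
move=> bip; apply: specialization_upsets; first exact: orientation_refl.
exact: orientation_trans.
Qed.

Lemma specialization_indiscrete x y : specialization indiscrete x y.
Proof. by rewrite specialization_upsets. Qed.

Lemma orientation_topology_of X1 X2 :
  bipartition e X1 X2 -> orientation_topology X1 X2 \in topologies_of e.
Proof.
move=> bip; apply/topologies_ofP; split; first exact: topology_upsets.
move=> x y; rewrite !specialization_orientation // /orientation.
have [<- | nxy] /= := eqVneq x y; first by rewrite e_irr.
rewrite (e_sym y x); have [exy | nexy] := boolP (e x y); last by rewrite !andbF.
case/bipartitionP: bip => -> /(_ _ _ exy); rewrite !inE => ->.
by case: (x \in X1).
Qed.

(** * From a topology on a triangle-free graph to a bipartition *)

Section Orient.
Hypothesis e_tf : triangle_free e.
Variable O : {set {set T}}.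
Hypothesis Oe : O \in topologies_of e.
Notation le := (specialization O).

(** Three distinct points in a chain are pairwise comparable by transitivity, hence form a
    triangle. *)
Lemma specialization_chain z x y :
  le z x -> le x y -> z != x -> x != y -> z = y.
Proof.
move=> zx xy nzx nxy; apply/eqP/negPn/negP=> nzy.
have [_ eE] := topologies_ofP _ Oe.
have := e_tf z x y; rewrite !eE nzx nxy eq_sym nzy zx xy /=.
by rewrite (specialization_trans zx xy) orbT.
Qed.

(* Two-point indiscrete components are oriented by [enum_rank]. *)
Definition strict_specialization : rel T := fun x y =>
  [&& x != y, le x y & ~~ le y x || (enum_rank x < enum_rank y)].
Notation lt := strict_specialization.

Lemma strict_specialization_edge x y : e x y = lt x y || lt y x.
Proof.
have [_ ->] := topologies_ofP _ Oe; rewrite /lt (eq_sym y x).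
have [//|nxy] /= := eqVneq x y.
case: (le x y) (le y x) => [] [] //=; rewrite -neq_ltn.
by rewrite (inj_eq val_inj) (inj_eq enum_rank_inj) nxy.
Qed.

(** A chain of two strict steps would return to its start, so its two points would be equivalent and
    each would have the smaller rank. *)
Lemma strict_specialization_chain z x y : lt z x -> ~~ lt x y.
Proof.
case/and3P=> nzx zx H; apply/negP=> /and3P[nxy xy].
have zy := specialization_chain zx xy nzx nxy; subst z.
rewrite zx /= => ltxy; move: H; rewrite xy /=.
by rewrite ltnNge (ltnW ltxy).
Qed.

(** Only minimality is tested, so isolated vertices fall on this side. *)
Definition lower_part : {set T} := [set y | [forall x, ~~ lt x y]].

Lemma bipartition_lower_part : bipartition e lower_part (~: lower_part).
Proof.
have ltP x y : lt x y -> (x \in lower_part) && (y \notin lower_part).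
  move=> xy; rewrite !inE; apply/andP; split.
    apply/forallP=> z; apply: contraL xy; exact: strict_specialization_chain.
  by apply/forallPn; exists x; rewrite xy.
apply/bipartitionP; split=> // x y; rewrite strict_specialization_edge.
by case/orP=> /ltP/andP[]; [move=> -> /negPf-> | move=> -> /negPf->].
Qed.

(** Antisymmetry makes the tie-breaking by rank vacuous, so [lt] is the strict part of [le] and [le]
    can be recovered from the graph and its lower side. *)
Lemma orientation_topology_lower_part : antisymmetric le ->
  O = orientation_topology lower_part (~: lower_part).
Proof.
move=> anti; have [tO _] := topologies_ofP _ Oe.
rewrite -[LHS](upsets_specialization tO); apply: eq_upsets => x y.
have ltE a b : lt a b = (a != b) && le a b.
  rewrite /lt; have [//|nab] /= := eqVneq a b.
  case ab: (le a b); case ba: (le b a) => //=.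
  by rewrite (anti a b) ?ab ?ba ?eqxx in nab.
rewrite /orientation; have [<- | nxy] /= := eqVneq x y.
  exact: specialization_refl.
have -> : le x y = lt x y by rewrite ltE nxy.
rewrite strict_specialization_edge !inE.
apply/idP/and3P => [xy | [/forallP/(_ y)/negPf-> _]]; last by rewrite orbF.
split; last by rewrite xy.
  by apply/forallP=> z; apply: contraL xy; exact: strict_specialization_chain.
by apply/forallPn; exists x; rewrite xy.
Qed.

(** A neighbour of one of two equivalent points extends the pair to a chain, and so must be the
    other point. The pair is thus closed under adjacency. *)
Lemma two_point_component x y : connected e ->
  x != y -> le x y -> le y x -> forall z, z \in [set x; y].
Proof.
move=> conn nxy xy yx z; have [_ eE] := topologies_ofP _ Oe.
have nbr a b c : le a b -> le b a -> a != b -> e a c -> c = b.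
  move=> ab ba nab; rewrite eE => /andP[nac /orP[ac | ca]].
    by symmetry; apply: (specialization_chain ba ac); rewrite // eq_sym.
  by apply: (specialization_chain ca ab); rewrite // eq_sym.
have cl : closed e (mem [set x; y]).
  apply: intro_closed; first exact: sym_connect_sym.
  move=> a b eab; rewrite !inE => /orP[] /eqP Ea; subst a.
    by rewrite (nbr _ _ _ xy yx nxy eab) eqxx orbT.
  by rewrite (nbr _ _ _ yx xy _ eab) ?eqxx // eq_sym.
by rewrite -(closed_connect cl (conn x z)) !inE eqxx.
Qed.

Lemma indiscrete_K2 : connected e -> ~ antisymmetric le ->
  is_K2 e /\ O = indiscrete.
Proof.
move=> conn nanti; have [tO eE] := topologies_ofP _ Oe.
have [x [y [nxy xy yx]]] : exists x y, [/\ x != y, le x y & le y x].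
  have [/existsP[x /existsP[y /and3P[? ? ?]]] | none] :=
    boolP [exists x, exists y, [&& x != y, le x y & le y x]].
    by exists x, y.
  case: nanti => x y /andP[xy yx]; apply/eqP/negPn/negP=> nxy.
  by case/existsP: none; exists x; apply/existsP; exists y; apply/and3P.
have all2 := two_point_component conn nxy xy yx.
have le_all a b : le a b.
  move: (all2 a) (all2 b); rewrite !inE.
  by move=> /orP[]/eqP-> /orP[]/eqP->; rewrite ?specialization_refl.
split; last first.
  rewrite -[LHS](upsets_specialization tO).
  by apply: eq_upsets => a b; rewrite le_all.
apply/andP; split.
  have <- : #|[set x; y]| = #|T| by apply: eq_card => z; rewrite all2.
  by rewrite cards2 nxy.
by apply/forallP=> a; apply/forallP=> b; rewrite eE !le_all andbT.
Qed.

End Orient.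

(** * Counting topologies and homeomorphism classes on a connected graph *)

Section Connected.
Hypotheses (e_tf : triangle_free e) (conn : connected e) (T_gt1 : 2 <= #|T|).
Variables X1 X2 : {set T}.
Hypothesis bip : bipartition e X1 X2.
Notation O12 := (orientation_topology X1 X2).
Notation O21 := (orientation_topology X2 X1).

Lemma connected_neighbor x : exists y, e x y.
Proof.
have [/existsP // | /existsPn none] := boolP [exists y, e x y].
have [y nyx] : exists y, y != x.
  apply/existsP; rewrite -[X in is_true X]negbK; apply/negP=> /existsPn H.
  have : #|T| <= #|[set x]|.
    by apply/subset_leq_card/subsetP=> y _; rewrite inE; apply/negPn/H.
  by rewrite cards1 leqNgt T_gt1.
(* The path from [x] to the different point [y] is nonempty; its first step leads to a neighbour. *)
have /connectP[[|z p] /= ez Ey] := conn x y; first by rewrite Ey eqxx in nyx.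
by move: ez; rewrite (negPf (none z)).
Qed.

Lemma orientation_edge x y : e x y -> x \in X1 ->
  [/\ orientation X1 X2 x y, ~~ orientation X1 X2 y x
    & ~~ orientation X2 X1 x y].
Proof.
case/bipartitionP: bip => -> E exy xX1; have := E _ _ exy.
have nxy : x != y by apply: contraTneq exy => ->; rewrite e_irr.
rewrite /orientation (eq_sym y x) (negPf nxy) !inE (e_sym y x) exy xX1 /=.
by move=> ->.
Qed.

Lemma directed_edge_exists : exists x y, e x y /\ x \in X1.
Proof.
have /card_gt0P[x _] : 0 < #|T| by apply: ltnW.
have [y exy] := connected_neighbor x.
have [xX|xX] := boolP (x \in X1); first by exists x, y.
exists y, x; rewrite e_sym; split=> //.
by case/bipartitionP: bip => _ /(_ _ _ exy) ->.
Qed.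

Lemma orientation_topology_neq : O12 != O21.
Proof.
have [x [y [exy xX]]] := directed_edge_exists.
have [xy _ /negPf xy'] := orientation_edge exy xX.
apply/eqP=> /(congr1 (fun O => specialization O x y)).
rewrite (specialization_orientation bip).
by rewrite (specialization_orientation (bipartition_sym bip)) xy xy'.
Qed.

(** An edge is ordered one way only by [O12], whereas [indiscrete] relates all points both ways. *)
Lemma indiscrete_not_orientation :
  ~~ homeomorphic O12 indiscrete.
Proof.
apply/negP; case/homeomorphicP; rewrite ?topology_upsets // => s H.
have [x [y [exy xX]]] := directed_edge_exists.
have [_ + _] := orientation_edge exy xX.
by rewrite -specialization_orientation // H specialization_indiscrete.
Qed.

Lemma indiscrete_topology_of : is_K2 e -> indiscrete \in topologies_of e.
Proof.
case/andP=> _ /forallP eE; apply/topologies_ofP; split.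
  exact: topology_upsets.
move=> x y; rewrite !specialization_indiscrete andbT.
exact/eqP/(forallP (eE x)).
Qed.

(** The split is on antisymmetry of the specialization preorder: if it holds, uniqueness of the
    bipartition leaves two orientations; if it fails, the space is an indiscrete pair. *)
Lemma connected_topologies_of : topologies_of e =
  [set O12; O21] :|: (if is_K2 e then [set indiscrete] else set0).
Proof.
apply/setP=> O; apply/idP/idP => [Oe | ].
  have [anti | nanti] := boolP
    [forall x, forall y,
       specialization O x y && specialization O y x ==> (x == y)].
    have {}anti : antisymmetric (specialization O).
      by move=> x y xy; have /forallP/(_ y)/implyP/(_ xy)/eqP := forallP anti x.
    have EO := orientation_topology_lower_part e_tf Oe anti.
    have := bipartition_unique conn bip (bipartition_lower_part e_tf Oe).
    by case=> -[E1 E2]; rewrite E2 E1 in EO; rewrite EO !inE eqxx ?orbT.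
  have [| K2 ->] := indiscrete_K2 e_tf Oe conn.
    move=> anti; case/negP: nanti; apply/forallP=> x; apply/forallP=> y.
    by apply/implyP=> /anti->.
  by rewrite K2 !inE eqxx orbT.
case/setUP=> [/set2P[] -> | ].
- exact: orientation_topology_of.
- exact/orientation_topology_of/bipartition_sym.
case: ifP => [K2 /set1P-> | _]; first exact: indiscrete_topology_of.
by rewrite in_set0.
Qed.

Lemma connected_tau_bar : tau_bar e = if is_K2 e then 3 else 2.
Proof.
rewrite /tau_bar connected_topologies_of.
case: ifP => _; last by rewrite setU0 cards2 orientation_topology_neq.
rewrite setUC cardsU1 cards2 orientation_topology_neq !inE.
have neq : indiscrete != O12.
  apply: contraNneq indiscrete_not_orientation => ->.
  exact: homeomorphic_refl.
suff -> : (indiscrete == O21) = false by rewrite (negPf neq).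
have [x [y [exy xX]]] := directed_edge_exists.
have [_ _ /negPf xy'] := orientation_edge exy xX.
apply/negP=> /eqP /(congr1 (fun O => specialization O x y)).
rewrite specialization_indiscrete.
by rewrite (specialization_orientation (bipartition_sym bip)) xy'.
Qed.

(** An order isomorphism preserves comparability, hence is a graph automorphism, and it sends lower
    ends of edges to lower ends. Conversely an automorphism exchanging the sides carries one
    orientation to the other. *)
Lemma homeomorphic_orientation : homeomorphic O12 O21 = reflexible e.
Proof.
have bip' := bipartition_sym bip.
have [defX2 E] := bipartitionP _ _ bip.
have swap (s : {perm T}) : automorphism e s -> s @: X1 = X2 ->
    homeomorphic O12 O21.
  move=> /forallP aut sX; apply/homeomorphicP; rewrite ?topology_upsets //.
  exists s => x y; rewrite !specialization_orientation //.
  have es : e (s x) (s y) = e x y by apply/eqP/(forallP (aut x)).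
  have s1 z : (s z \in X2) = (z \in X1).
    by rewrite -sX mem_imset //; apply: perm_inj.
  have s2 z : (s z \in X1) = (z \in X2).
    by have := s1 z; rewrite defX2 !inE => <-; rewrite negbK.
  by rewrite /orientation (inj_eq perm_inj) es s1 s2.
apply/idP/existsP => [|[Y1 /existsP[Y2]]].
  case/homeomorphicP; rewrite ?topology_upsets // => s Hs.
  have {}Hs x y : orientation X1 X2 x y = orientation X2 X1 (s x) (s y).
    by rewrite -!specialization_orientation.
  exists X1; apply/existsP; exists X2; rewrite bip; apply/existsP; exists s.
  have [_ e1] := topologies_ofP _ (orientation_topology_of bip).
  have [_ e2] := topologies_ofP _ (orientation_topology_of bip').
  apply/andP; split.
    apply/forallP=> x; apply/forallP=> y; rewrite e2 e1 (inj_eq perm_inj).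
    by rewrite !specialization_orientation // !Hs.
  have sub x y : e x y -> x \in X1 -> (s x \in X2) && (s y \in X1).
    move=> exy xX; have [+ _ _] := orientation_edge exy xX.
    rewrite Hs => /orP[/eqP/perm_inj Exy | ].
      by rewrite Exy e_irr in exy.
    by case/and3P=> -> ->.
  (* Every vertex lies on some edge, and the image of that edge determines the side of [s z]. *)
  have s1 z : (s z \in X2) = (z \in X1).
    have [y ezy] := connected_neighbor z.
    have [zX | zX] := boolP (z \in X1); first by have /andP[] := sub _ _ ezy zX.
    have yX : y \in X1 by rewrite (E _ _ ezy).
    rewrite e_sym in ezy; have /andP[_] := sub _ _ ezy yX.
    by rewrite defX2 inE => ->.
  apply/eqP/setP=> z; rewrite -[z](permKV s) mem_imset ?s1 //; exact: perm_inj.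
case/andP=> bipY /existsP[s /andP[aut /eqP sY]].
case: (bipartition_unique conn bip bipY) => -[E1 E2].
  by rewrite E1 E2 in sY; apply: swap sY.
(* Here reflexibility is witnessed by the parts in reverse order; [s] maps [X2] onto [X1], and
   complements give [X1] onto [X2]. *)
rewrite E1 E2 in sY; apply: (swap s) => //; apply/setP=> z.
rewrite -[z](permKV s) mem_imset; last exact: perm_inj.
set w := (s^-1)%g z.
have : (s w \in X1) = (w \in X2) by rewrite -sY mem_imset //; apply: perm_inj.
by rewrite defX2 !inE => ->; rewrite negbK.
Qed.

(** The transposition of the two ends is the required automorphism. It makes both orientations of
    [K2] homeomorphic. *)
Lemma is_K2_reflexible : is_K2 e -> reflexible e.
Proof.
case/andP=> _ /forallP eE; apply/existsP; exists X1; apply/existsP; exists X2.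
have {}eE x y : e x y = (x != y) by apply/eqP/(forallP (eE x)).
have [defX2 E] := bipartitionP _ _ bip.
have [x [y [exy xX]]] := directed_edge_exists.
rewrite bip; apply/existsP; exists (tperm x y); apply/andP; split.
  by apply/forallP=> a; apply/forallP=> b; rewrite !eE (inj_eq perm_inj).
have defX1 : X1 = [set x].
  apply/setP=> z; rewrite inE; have [-> // | nzx] := eqVneq z x.
  by rewrite (E x z) ?xX // eE eq_sym.
rewrite defX1 imset_set1 tpermL defX2 defX1; apply/eqP/setP=> z; rewrite !inE.
have [-> | nzy] := eqVneq z y; first by rewrite eq_sym -eE exy.
(* A third vertex would be adjacent to both [x] and [y], which lie in different parts. *)
apply/esym/negbTE; rewrite negbK -[_ == _]negbK -eE; apply/negP=> ezx.
have yX : y \notin X1 by rewrite (E x y) // xX.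
have : z \in X1 by rewrite (E y z) // eE eq_sym.
by rewrite (E x z) ?xX // e_sym.
Qed.

Lemma homeomorphism_class_eq (D : {set {set {set T}}}) A B :
  B \in D ->
  ([set C in D | homeomorphic A C] == [set C in D | homeomorphic B C])
    = homeomorphic A B.
Proof.
move=> BD; apply/eqP/idP => [/setP/(_ B) | AB].
  by rewrite !inE BD homeomorphic_refl.
apply/setP=> C; rewrite !inE; congr (_ && _); apply/idP/idP.
  by apply: homeomorphic_trans; rewrite homeomorphic_sym.
exact: homeomorphic_trans.
Qed.

(** Although [K2] is reflexible, its indiscrete topology forms a second class beside the one shared
    by the two orientations; hence [is_K2] is excluded from the value 1. *)
Lemma connected_hbar :
  hbar e = if ~~ is_K2 e && reflexible e then 1 else 2.
Proof.
have O21e := orientation_topology_of (bipartition_sym bip).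
pose cls A := [set C in topologies_of e | homeomorphic A C].
(* The partition is by definition the image of the class map, so it suffices to compare the classes
   of the listed topologies. *)
have -> : hbar e = #|cls @: topologies_of e| by [].
rewrite connected_topologies_of imsetU imsetU1 imset_set1.
case: ifP => K2; last first.
  rewrite imset0 setU0 cards2 homeomorphism_class_eq //.
  by rewrite homeomorphic_orientation; case: (reflexible e).
rewrite imset_set1 /=.
have -> : cls O12 = cls O21.
  apply/eqP; rewrite homeomorphism_class_eq // homeomorphic_orientation.
  exact: is_K2_reflexible.
rewrite setUid cards2 homeomorphism_class_eq ?indiscrete_topology_of //.
suff -> : homeomorphic O21 indiscrete = false by [].
apply: contraNF indiscrete_not_orientation; apply: homeomorphic_trans.
by rewrite homeomorphic_orientation is_K2_reflexible.
Qed.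

End Connected.

End TriangleFree.

Theorem theorem2p7 (T : finType) (e : rel T)
    (e_sym : symmetric e) (e_irr : irreflexive e) (e_tf : triangle_free e) :
  (tau_bar e <> 0 <-> bipartite e) /\
  (connected e -> bipartite e -> 2 <= #|T| ->
     tau_bar e = (if is_K2 e then 3 else 2) /\
     hbar e = (if ~~ is_K2 e && reflexible e then 1 else 2)).
Proof.
split; last first.
  move=> conn /existsP[X1 /existsP[X2 bip]] T_gt1.
  by rewrite (connected_tau_bar e_sym e_irr e_tf conn T_gt1 bip)
             (connected_hbar e_sym e_irr e_tf conn T_gt1 bip).
split=> [/eqP | /existsP[X1 /existsP[X2 bip]]].
  rewrite cards_eq0 => /set0Pn[O Oe]; apply/existsP.
  exists (lower_part O); apply/existsP; exists (~: lower_part O).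
  exact: bipartition_lower_part Oe.
apply/eqP; rewrite cards_eq0; apply/set0Pn.
exists (orientation_topology e X1 X2); exact: orientation_topology_of.
Qed.
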